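(* Let $R$ be a commutative noetherian ring and $B$ a finite $R$-module. Assume that $x,y\in R$ form a pair of exact zero-divisors on both $R$ and $B$. Then the following statements are equivalent. (i) $B$ is a semidualizing $R$-module. (ii) $B/xB$ is a semidualizing $R/xR$-module and $B/yB$ is a semidualizing $R/yR$-module.
   Context: Rings are commutative noetherian with identity; ''finite'' means finitely generated. A finite module $B$ over a ring $A$ is semidualizing if the natural homothety map $A\to\operatorname{Hom}_A(B,B)$ is an isomorphism and $\operatorname{Ext}^i_A(B,B)=0$ for all $i>0$. For an $R$-module $M$ and $x,y\in R$, one says that $x,y$ form a pair of exact zero-divisors on $M$ if $xM\neq 0$, $xM\neq M$ and the sequence of multiplication maps $M\xrightarrow{x}M\xrightarrow{y}M\xrightarrow{x}M$ is exact. *)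

(* Defs.v *)
From HB Require Import structures.
From mathcomp Require Import all_boot all_algebra.
From mathcomp Require Import boolp functions.

Set Implicit Arguments.
Unset Strict Implicit.
Unset Printing Implicit Defensive.

Import GRing.Theory.
Local Open Scope ring_scope.
Local Open Scope quotient_scope.

(* Rings are [comPzRingType], so that the zero ring is allowed and R/xR is a
   ring for every x. A ring R, viewed as a module over itself, is R^o. *)

Definition finite_module (A : comPzRingType) (M : lmodType A) : Prop :=
  exists n (g : 'I_n -> M), forall m, exists c : 'I_n -> A,
    m = \sum_(i < n) c i *: g i.

Definition noetherian (A : comPzRingType) : Prop :=
  forall I : {pred A^o}, submod_closed I ->
    exists n (g : 'I_n -> A^o), forall r,
      r \in I <-> exists c : 'I_n -> A, r = \sum_(i < n) c i *: g i.

Definition exact_zero_divisors (A : comPzRingType) (M : lmodType A)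
    (x y : A) : Prop :=
  [/\ exists m : M, x *: m != 0,
      exists m : M, ~ exists n : M, m = x *: n,
      forall m : M, y *: m = 0 <-> exists n, m = x *: n &
      forall m : M, x *: m = 0 <-> exists n, m = y *: n].

Section MultiplesOf.
Variables (A : comPzRingType) (x : A) (M : lmodType A).

Definition mults : {pred M} := [pred m | `[< exists n : M, m = x *: n >]].

Lemma multsP m : reflect (exists n, m = x *: n) (m \in mults).
Proof. exact: asboolP. Qed.

Lemma mults_zmod_closed : zmod_closed mults.
Proof.
split=> [|_ _ /multsP[m ->] /multsP[n ->]]; apply/multsP.
  by exists 0; rewrite scaler0.
by exists (m - n); rewrite scalerBr.
Qed.

HB.instance Definition _ := GRing.isZmodClosed.Build M mults mults_zmod_closed.

End MultiplesOf.

Arguments mults {A} x M _.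

Section QuotientRing.
Variables (A : comPzRingType) (x : A).

Definition quot_ring : Type := Quotient.quot (mults x A^o).
HB.instance Definition _ := Choice.on quot_ring.
HB.instance Definition _ := GRing.Zmodule.on quot_ring.

Definition ring_pi : A -> quot_ring := \pi_(Quotient.quot (mults x A^o)).

Lemma ring_piP a b : ring_pi a = ring_pi b <-> exists c, a - b = x * c.
Proof.
rewrite /ring_pi; split=> [/eqP|[c abE]].
  by rewrite -Quotient.idealrBE => /multsP.
by apply/eqP; rewrite -Quotient.idealrBE; apply/multsP; exists c.
Qed.

Lemma ring_pi_repr (u : quot_ring) : ring_pi (repr u) = u.
Proof. exact: reprK. Qed.

Lemma ring_pi_is_zmod_morphism : zmod_morphism ring_pi.
Proof. exact: (raddfB \pi_(Quotient.quot (mults x A^o))). Qed.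

Definition quot_one : quot_ring := ring_pi 1.
Definition quot_mul (u v : quot_ring) : quot_ring :=
  ring_pi (repr u * repr v).

Lemma quot_mulE a b : quot_mul (ring_pi a) (ring_pi b) = ring_pi (a * b).
Proof.
have /ring_piP[c ac] := ring_pi_repr (ring_pi a).
have /ring_piP[d bd] := ring_pi_repr (ring_pi b).
apply/ring_piP; exists (c * repr (ring_pi b) + a * d).
rewrite mulrDr mulrA -ac mulrBl mulrCA -bd mulrBr.
by rewrite addrA subrK.
Qed.

Lemma quot_mulA : associative quot_mul.
Proof.
move=> u v w; rewrite -(ring_pi_repr u) -(ring_pi_repr v) -(ring_pi_repr w).
by rewrite !quot_mulE mulrA.
Qed.

Lemma quot_mulC : commutative quot_mul.
Proof. by move=> u v; rewrite /quot_mul mulrC. Qed.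

Lemma quot_mul1 : left_id quot_one quot_mul.
Proof. by move=> u; rewrite -(ring_pi_repr u) quot_mulE mul1r. Qed.

Lemma quot_mulDl : left_distributive quot_mul +%R.
Proof.
have piD a b : ring_pi (a + b) = ring_pi a + ring_pi b.
  exact: (raddfD \pi_(Quotient.quot (mults x A^o))).
move=> u v w; rewrite -(ring_pi_repr u) -(ring_pi_repr v) -(ring_pi_repr w).
by rewrite -piD !quot_mulE -piD mulrDl.
Qed.

HB.instance Definition _ := GRing.Zmodule_isComPzRing.Build quot_ring
  quot_mulA quot_mulC quot_mul1 quot_mulDl.

HB.instance Definition _ :=
  GRing.isZmodMorphism.Build A quot_ring ring_pi ring_pi_is_zmod_morphism.

Lemma ring_pi_is_monoid_morphism : monoid_morphism ring_pi.
Proof. by split=> // a b; rewrite -quot_mulE. Qed.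

HB.instance Definition _ :=
  GRing.isMonoidMorphism.Build A quot_ring ring_pi ring_pi_is_monoid_morphism.

End QuotientRing.

Section QuotientModule.
Variables (A : comPzRingType) (x : A) (M : lmodType A).

Definition quot_mod : Type := Quotient.quot (mults x M).
HB.instance Definition _ := Choice.on quot_mod.
HB.instance Definition _ := GRing.Zmodule.on quot_mod.

Definition mod_pi : M -> quot_mod := \pi_(Quotient.quot (mults x M)).

Lemma mod_piP m n : mod_pi m = mod_pi n <-> exists p, m - n = x *: p.
Proof.
rewrite /mod_pi; split=> [/eqP|[c abE]].
  by rewrite -Quotient.idealrBE => /multsP.
by apply/eqP; rewrite -Quotient.idealrBE; apply/multsP; exists c.
Qed.

Lemma mod_pi_repr (u : quot_mod) : mod_pi (repr u) = u.
Proof. exact: reprK. Qed.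

Lemma mod_pi_is_zmod_morphism : zmod_morphism mod_pi.
Proof. exact: (raddfB \pi_(Quotient.quot (mults x M))). Qed.

HB.instance Definition _ :=
  GRing.isZmodMorphism.Build M quot_mod mod_pi mod_pi_is_zmod_morphism.

Definition quot_scale (u : quot_ring x) (v : quot_mod) : quot_mod :=
  mod_pi (repr u *: repr v).

Lemma quot_scaleE a m : quot_scale (ring_pi x a) (mod_pi m) = mod_pi (a *: m).
Proof.
have /ring_piP[c ac] := ring_pi_repr (ring_pi x a).
have /mod_piP[n mn] := mod_pi_repr (mod_pi m).
apply/mod_piP; exists (c *: repr (mod_pi m) + a *: n).
rewrite scalerDr scalerA -ac scalerBl scalerA [x * a]mulrC -scalerA -mn.
by rewrite scalerBr addrA subrK.
Qed.

Lemma quot_scaleA u v w : quot_scale u (quot_scale v w) = quot_scale (u * v) w.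
Proof.
rewrite -(ring_pi_repr u) -(ring_pi_repr v) -(mod_pi_repr w).
by rewrite -rmorphM !quot_scaleE scalerA.
Qed.

Lemma quot_scale1 : left_id 1 quot_scale.
Proof. by move=> w; rewrite -(mod_pi_repr w) quot_scaleE scale1r. Qed.

Lemma quot_scaleDr : right_distributive quot_scale +%R.
Proof.
move=> u v w; rewrite -(ring_pi_repr u) -(mod_pi_repr v) -(mod_pi_repr w).
by rewrite -raddfD !quot_scaleE scalerDr raddfD.
Qed.

Lemma quot_scaleDl w : {morph quot_scale^~ w : u v / u + v}.
Proof.
move=> u v; rewrite -(ring_pi_repr u) -(ring_pi_repr v) -(mod_pi_repr w).
by rewrite -rmorphD !quot_scaleE scalerDl raddfD.
Qed.

HB.instance Definition _ := GRing.Zmodule_isLmodule.Build (quot_ring x) quot_mod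
  quot_scaleA quot_scale1 quot_scaleDr quot_scaleDl.

Lemma mod_piZ a m : mod_pi (a *: m) = ring_pi x a *: mod_pi m.
Proof. by rewrite -quot_scaleE. Qed.

End QuotientModule.

Definition projective (A : comPzRingType) (P : lmodType A) : Prop :=
  forall (M N : lmodType A) (g : {linear M -> N}) (f : {linear P -> N}),
    (forall n, exists m, g m = n) ->
    exists h : {linear P -> M}, forall p, g (h p) = f p.

Record projective_resolution (A : comPzRingType) (M : lmodType A) := {
  res_obj :> nat -> lmodType A;
  res_diff : forall i, {linear res_obj i.+1 -> res_obj i};
  res_aug : {linear res_obj 0 -> M};
  res_proj : forall i, projective (res_obj i);
  res_aug_surj : forall m, exists p, res_aug p = m;
  res_exact0 : forall p, res_aug p = 0 <-> exists q, res_diff 0 q = p;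
  res_exact : forall i p,
    res_diff i p = 0 <-> exists q, res_diff i.+1 q = p
}.

(* The differentials of Hom_A(P, N) are given by precomposition with those
   of P. *)
Definition cocycle (A : comPzRingType) (M N : lmodType A)
    (P : projective_resolution M) (i : nat) (f : {linear P i -> N}) : Prop :=
  forall p, f (res_diff P i p) = 0.

Definition coboundary (A : comPzRingType) (M N : lmodType A)
    (P : projective_resolution M) (i : nat) : {linear P i -> N} -> Prop :=
  match i with
  | 0 => fun f => forall p, f p = 0
  | j.+1 => fun f =>
      exists g : {linear P j -> N}, forall p, f p = g (res_diff P j p)
  end.

(* Ext^i_A(M, N) = H^i(Hom_A(P, N)) is, up to isomorphism, independent of the
   projective resolution P of M. The quantification over P is not vacuous: see
   [projective_resolution_exists]. *)
Definition Ext_eq0 (A : comPzRingType) (i : nat) (M N : lmodType A) : Prop :=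
  forall (P : projective_resolution M) (f : {linear P i -> N}),
    cocycle f -> coboundary f.

(* Bijectivity of [homothety] is meant for extensional equality of linear maps,
   which is Leibniz equality by [linear_ext]. *)
Lemma linear_ext (A : comPzRingType) (M N : lmodType A)
    (f g : {linear M -> N}) : f =1 g -> f = g.
Proof.
move=> /funext; case: f g => [f [[fA] [fZ]]] [g [[gA] [gZ]]] /= fg.
case: _ / fg gA gZ => gA gZ.
congr (GRing.Linear.Pack (GRing.Linear.Class _ _)); f_equal;
  exact: Prop_irrelevance.
Qed.

Definition homothety (A : comPzRingType) (B : lmodType A) (a : A) :
  {linear B -> B} := *:%R a.

Definition semidualizing (A : comPzRingType) (B : lmodType A) : Prop :=
  [/\ finite_module B,
      bijective (@homothety A B) &
      forall i, (0 < i)%N -> Ext_eq0 i B B].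

Section FreeModule.
Variables (A : comPzRingType) (T : choiceType).

Definition fin_supp : {pred (T -> A^o)} :=
  [pred f | `[< exists s : seq T, forall t, t \notin s -> f t = 0 >]].

Lemma fin_supp_closed : submod_closed fin_supp.
Proof.
split=> [|a f g /asboolP[s fs] /asboolP[r gr]]; apply/asboolP.
  by exists [::].
exists (s ++ r) => t; rewrite mem_cat negb_or => /andP[/fs ft /gr gt].
by rewrite -[LHS]/(a *: f t + g t) ft gt scaler0 addr0.
Qed.

HB.instance Definition _ :=
  GRing.isSubmodClosed.Build A (T -> A^o) fin_supp fin_supp_closed.

(* The free A-module on T: functions T -> A of finite support. *)
Record freemod :=
  Freemod { freemod_val : T -> A^o; _ : freemod_val \in fin_supp }.

HB.instance Definition _ := [isSub for freemod_val].
HB.instance Definition _ := [Choice of freemod by <:].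
HB.instance Definition _ := [SubChoice_isSubLmodule of freemod by <:].

Definition coef (v : freemod) : T -> A := freemod_val v.
Coercion coef : freemod >-> Funclass.

Lemma free_ext (v w : freemod) : (forall t, v t = w t) -> v = w.
Proof. by move=> vw; apply: val_inj; apply/funext. Qed.

Lemma freeD (v w : freemod) t : (v + w) t = v t + w t.
Proof. by []. Qed.

Lemma freeZ (a : A) (v : freemod) t : (a *: v) t = a * v t.
Proof. by []. Qed.

Lemma free_sum (I : Type) (s : seq I) (F : I -> freemod) t :
  (\sum_(i <- s) F i) t = \sum_(i <- s) F i t.
Proof.
by elim: s => [|i s IHs]; rewrite ?big_nil ?big_cons // freeD IHs.
Qed.

Lemma free_supp_ex (v : freemod) :
  exists s : seq T, uniq s /\ forall t, t \notin s -> v t = 0.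
Proof.
case: v => f /= /asboolP[s fs]; exists (undup s).
by split=> [|t]; rewrite ?undup_uniq // mem_undup; apply: fs.
Qed.

Definition supp (v : freemod) : seq T := projT1 (cid (free_supp_ex v)).

Lemma supp_uniq v : uniq (supp v).
Proof. by rewrite /supp; case: cid => s []. Qed.

Lemma suppP v t : t \notin supp v -> v t = 0.
Proof. by rewrite /supp; case: cid => s [] /= _; apply. Qed.

Lemma single_subproof t : (fun u => (u == t)%:R : A^o) \in fin_supp.
Proof. by apply/asboolP; exists [:: t] => u; rewrite inE => /negbTE ->. Qed.

Definition single t : freemod := Freemod (single_subproof t).

Section Lift.
Variables (N : lmodType A) (h : T -> N).

Definition free_lift (v : freemod) : N := \sum_(t <- supp v) v t *: h t.

Lemma free_liftE (v : freemod) (s : seq T) : uniq s -> (forall t, t \notin s -> v t = 0) ->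
  free_lift v = \sum_(t <- s) v t *: h t.
Proof.
move=> s_uniq s_supp; rewrite /free_lift.
rewrite (bigID (mem s)) /= addrC big1 ?add0r; last first.
  by move=> t /s_supp ->; rewrite scale0r.
rewrite [RHS](bigID (mem (supp v))) /= addrC [X in X + _]big1 ?add0r; last first.
  by move=> t /suppP ->; rewrite scale0r.
rewrite -big_filter -[RHS]big_filter; apply: perm_big.
apply: uniq_perm; rewrite ?filter_uniq ?supp_uniq // => t.
by rewrite !mem_filter andbC.
Qed.

Lemma free_lift_linear : linear free_lift.
Proof.
move=> a v w; pose s := undup (supp v ++ supp w).
have s_uniq : uniq s by apply: undup_uniq.
have sP t : t \notin s -> v t = 0 /\ w t = 0.
  by rewrite mem_undup mem_cat negb_or => /andP[/suppP ? /suppP].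
rewrite (@free_liftE v s) ?(@free_liftE w s) ?(@free_liftE _ s) //;
  try by move=> t /sP[].
  rewrite scaler_sumr -big_split; apply: eq_bigr => t _.
  by rewrite freeD freeZ scalerDl scalerA.
by move=> t /sP[vt wt]; rewrite freeD freeZ vt wt mulr0 addr0.
Qed.

HB.instance Definition _ :=
  GRing.isLinear.Build A freemod N *:%R free_lift free_lift_linear.

Lemma free_lift_single t : free_lift (single t) = h t.
Proof.
rewrite (@free_liftE _ [:: t]) //; last first.
  by move=> u; rewrite inE /= => /negbTE ->.
by rewrite big_seq1 /= eqxx scale1r.
Qed.

End Lift.

Lemma free_expand (v : freemod) : v = \sum_(t <- supp v) v t *: single t.
Proof.
apply: free_ext => u; rewrite free_sum.
have [us|us] := boolP (u \in supp v); last first.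
  rewrite (suppP us) big_seq big1 // => t ts; rewrite freeZ.
  by rewrite {2}/coef /=; case: eqP ts us => [-> ->|_ _ _] //; rewrite mulr0.
rewrite (bigD1_seq u) ?supp_uniq // big1 => [|t tu].
  by rewrite freeZ /= addr0 /coef /= eqxx mulr1.
by rewrite freeZ /coef /= eq_sym (negbTE tu) mulr0.
Qed.

Lemma free_projective : projective freemod.
Proof.
move=> M N g f g_surj.
have [h hP] := choice (fun t => g_surj (f (single t))).
exists (free_lift h) => v.
rewrite [RHS](congr1 f (free_expand v)) /free_lift !linear_sum /=.
by apply: eq_bigr => t _; rewrite !linearZ /= hP.
Qed.

End FreeModule.

Section KernelModule.
Variables (A : comPzRingType) (M N : lmodType A) (f : {linear M -> N}).

Definition ker_pred : {pred M} := [pred m | f m == 0].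

Lemma ker_pred_closed : submod_closed ker_pred.
Proof.
split=> [|a m n]; rewrite !inE ?linear0 // => /eqP fm /eqP fn.
by rewrite linearP fm fn scaler0 addr0.
Qed.

HB.instance Definition _ :=
  GRing.isSubmodClosed.Build A M ker_pred ker_pred_closed.

Record kermod := Kermod { kermod_val : M; _ : kermod_val \in ker_pred }.

HB.instance Definition _ := [isSub for kermod_val].
HB.instance Definition _ := [Choice of kermod by <:].
HB.instance Definition _ := [SubChoice_isSubLmodule of kermod by <:].

End KernelModule.

Section FreeResolution.
Variables (A : comPzRingType) (M : lmodType A).

Definition cover (N : lmodType A) : {linear freemod A N -> N} := free_lift id.

Lemma cover_surj (N : lmodType A) n : exists p, cover N p = n.
Proof. by exists (single A n); rewrite [LHS]free_lift_single. Qed.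

Fixpoint syzygy (i : nat) : lmodType A :=
  if i is j.+1 then kermod (cover (syzygy j)) else M.

Definition free_diff i :
    {linear freemod A (syzygy i.+1) -> freemod A (syzygy i)} :=
  (val : kermod (cover (syzygy i)) -> _) \o cover (syzygy i.+1).

Lemma free_diff_image i p :
  cover (syzygy i) p = 0 <-> exists q, free_diff i q = p.
Proof.
split=> [p0|[q <-]]; last by apply/eqP; apply: (valP (cover (syzygy i.+1) q)).
have pk : p \in ker_pred (cover (syzygy i)) by rewrite inE p0.
have [q qE] := cover_surj (Kermod pk : syzygy i.+1).
by exists q; rewrite /free_diff /= qE.
Qed.

Lemma free_diff_ker i p : free_diff i p = 0 <-> cover (syzygy i.+1) p = 0.
Proof.
rewrite /free_diff /=; split=> [p0|->] //; exact: val_inj.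
Qed.

Lemma free_diff_exact i p :
  free_diff i p = 0 <-> exists q, free_diff i.+1 q = p.
Proof. by rewrite free_diff_ker free_diff_image. Qed.

Definition free_resolution : projective_resolution M :=
  Build_projective_resolution (fun i => @free_projective A (syzygy i))
    (@cover_surj M) (@free_diff_image 0) free_diff_exact.

End FreeResolution.

Lemma projective_resolution_exists (A : comPzRingType) (M : lmodType A) :
  inhabited (projective_resolution M).
Proof. by split; apply: free_resolution. Qed.

(* Main.v *)
(* Let P be a projective resolution of B over R. Because x, y are exact on R, on
   every P_i and on B, the complex P/xP is a projective resolution of B/xB over
   R/xR, so Ext_{R/xR}(B/xB, B/xB) = Ext_R(B, B/xB), and likewise for y.
   Multiplication by y and by x gives exact sequences
     0 -> B/xB -> B -> B/yB -> 0   and   0 -> B/yB -> B -> B/xB -> 0.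
   If B is semidualizing, a map B -> B/xB followed by y : B/xB -> B is a homothety
   r with x r = 0, so r is in yR and Hom_R(B, B/xB) = R/xR; the surjection
   Hom_R(B, B) -> Hom_R(B, B/yB) gives Ext^1_R(B, B/xB) = 0, and
   Ext^(i+1)_R(B, B/xB) = Ext^i_R(B, B/yB) for i > 0 gives the rest by induction.
   The converse follows by comparing 0 -> R/yR -> R -> R/xR -> 0 with the second
   sequence. *)
Require Import Defs.
From HB Require Import structures.
From mathcomp Require Import all_boot all_algebra.
From mathcomp Require Import boolp.

Set Implicit Arguments.
Unset Strict Implicit.
Unset Printing Implicit Defensive.

Import GRing.Theory.
Local Open Scope ring_scope.

(** * Linear maps: descent along surjections and lifting from projectives *)

Section LinearMaps.
Variable A : comPzRingType.
Implicit Types M N L P : lmodType A.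

Lemma linear_map_exists M N (f : M -> N) :
  linear f -> exists g : {linear M -> N}, forall m, g m = f m.
Proof.
move=> f_lin.
pose g : {linear M -> N} :=
  HB.pack_for {linear M -> N} f (GRing.isLinear.Build A M N *:%R f f_lin).
by exists g.
Qed.

(** Compose [g] with a set-theoretic section of [p]; since [g] is constant on the fibres of [p], the
    composite is linear. *)
Lemma linear_factor M N L (p : {linear M -> N}) (g : {linear M -> L}) :
    (forall n, exists m, p m = n) -> (forall m, p m = 0 -> g m = 0) ->
  exists h : {linear N -> L}, forall m, h (p m) = g m.
Proof.
move=> /choice[s sK] pg.
have gE m m' : p m = p m' -> g m = g m'.
  move=> pmm'; apply/eqP; rewrite -subr_eq0 -linearB pg //.
  by rewrite linearB pmm' subrr.
have [|h hE] := @linear_map_exists N L (g \o s).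
  by move=> a u v /=; rewrite -linearP; apply: gE; rewrite linearP !sK.
by exists h => m; rewrite hE; apply: gE; rewrite sK.
Qed.

Lemma bijective_of_inj_surj (T U : Type) (f : T -> U) :
  injective f -> (forall u, exists t, f t = u) -> bijective f.
Proof. by move=> f_inj /choice[g gK]; exists g => // t; apply: f_inj. Qed.

Lemma surj_of_bijective (T U : Type) (f : T -> U) :
  bijective f -> forall u, exists t, f t = u.
Proof. by case=> g _ gK u; exists (g u). Qed.

(** By exactness [u] corestricts to a surjection onto the kernel of [v], where [f] takes its values;
    projectivity lifts [f] through it. *)
Lemma projective_lift_ker P M N L (u : {linear M -> N}) (v : {linear N -> L})
    (f : {linear P -> N}) :
    projective P -> (forall n, v n = 0 <-> exists m, n = u m) ->
    (forall p, v (f p) = 0) ->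
  exists g : {linear P -> M}, forall p, f p = u (g p).
Proof.
move=> P_proj uv vf.
have uker m : u m \in ker_pred v.
  by rewrite inE; apply/eqP/uv; exists m.
have fker p : f p \in ker_pred v by rewrite inE; apply/eqP.
have [|u' u'E] := @linear_map_exists M (kermod v) (fun m => Kermod (uker m)).
  by move=> a m n; apply: val_inj; rewrite /= linearP.
have [|f' f'E] := @linear_map_exists P (kermod v) (fun p => Kermod (fker p)).
  by move=> a m n; apply: val_inj; rewrite /= linearP.
have [|g gE] := P_proj _ _ u' f'.
  move=> [n nker]; have := nker; rewrite inE => /eqP /uv[m nm].
  by exists m; rewrite u'E; apply: val_inj.
by exists g => p; have /(congr1 val) := gE p; rewrite u'E f'E.
Qed.

End LinearMaps.

(** * Comparison theorem for projective resolutions and independence of Ext *)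

Section Comparison.
Variables (A : comPzRingType) (M : lmodType A).
Implicit Types P Q : projective_resolution M.

Lemma res_diffK P i p : res_diff P i (res_diff P i.+1 p) = 0.
Proof. by apply/res_exact; exists p. Qed.

Lemma res_augK P p : res_aug P (res_diff P 0 p) = 0.
Proof. by apply/res_exact0; exists p. Qed.

(** The [match] lets the augmentation serve as the differential out of degree 0, so that chain maps
    and homotopies are built uniformly. *)
Lemma lift_to_res_diff P i (X : lmodType A) (f : {linear X -> P i}) :
    projective X ->
    (forall u, match i return P i -> Prop with
               | 0 => fun p => res_aug P p = 0
               | j.+1 => fun p => res_diff P j p = 0
               end (f u)) ->
  exists g : {linear X -> P i.+1}, forall u, res_diff P i (g u) = f u.
Proof.
move=> X_proj fK.
suff [g gE] : exists g : {linear X -> P i.+1},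
    forall u, f u = res_diff P i (g u).
  by exists g => u; rewrite gE.
case: i f fK => [|i] f fK.
  apply: (projective_lift_ker (v := res_aug P)) => // p.
  by rewrite res_exact0; split=> -[q]; exists q.
apply: (projective_lift_ker (v := res_diff P i)) => // p.
by rewrite res_exact; split=> -[q]; exists q.
Qed.

Lemma comparison_map P Q : exists f : forall i, {linear P i -> Q i},
  (forall p, res_aug Q (f 0%N p) = res_aug P p) /\
  (forall i p, res_diff Q i (f i.+1 p) = f i (res_diff P i p)).
Proof.
have [f0 f0E] :=
  @res_proj _ _ P 0 _ _ (res_aug Q) (res_aug P) (@res_aug_surj _ _ Q).
have [f1 f1E] : exists f1 : {linear P 1%N -> Q 1%N},
    forall p, res_diff Q 0 (f1 p) = f0 (res_diff P 0 p).
  apply: (lift_to_res_diff (f := f0 \o res_diff P 0)) => [|p /=].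
    exact: res_proj.
  by rewrite f0E res_augK.
(* The map in degree [i.+2] exists only because the square below it commutes, so the recursion
   carries two consecutive maps with their square. *)
pose T i := {fg : {linear P i -> Q i} * {linear P i.+1 -> Q i.+1} |
  forall p, res_diff Q i (fg.2 p) = fg.1 (res_diff P i p)}.
have next i (t : T i) : {g : {linear P i.+2 -> Q i.+2} |
    forall p, res_diff Q i.+1 (g p) = (sval t).2 (res_diff P i.+1 p)}.
  apply: cid; case: t => -[f g] /= fgE.
  apply: (lift_to_res_diff (f := g \o res_diff P i.+1)) => [|p /=].
    exact: res_proj.
  by rewrite fgE res_diffK linear0.
pose step i (t : T i) : T i.+1 :=
  exist _ ((sval t).2, sval (next i t)) (svalP (next i t)).
pose t0 : T 0%N := exist _ (f0, f1) f1E.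
pose t := fix t i : T i := if i is j.+1 then step j (t j) else t0.
by exists (fun i => (sval (t i)).1); split=> // i p; apply: (svalP (t i)).
Qed.

(** Only two consecutive components are produced for each [i]; no coherent family is chosen, because
    Ext in one degree involves just these. *)
Lemma comparison_homotopy P (f : forall i, {linear P i -> P i}) :
    (forall p, res_aug P (f 0%N p) = res_aug P p) ->
    (forall i p, res_diff P i (f i.+1 p) = f i (res_diff P i p)) ->
  forall i, exists (h : {linear P i -> P i.+1}) (k : {linear P i.+1 -> P i.+2}),
    forall p, p - f i.+1 p = h (res_diff P i p) + res_diff P i.+1 (k p).
Proof.
move=> f_aug f_diff.
have next i (h : {linear P i -> P i.+1}) :
    (forall p, res_diff P i (h (res_diff P i p))
       = res_diff P i p - f i (res_diff P i p)) ->
    exists k : {linear P i.+1 -> P i.+2},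
      forall p, p - f i.+1 p = h (res_diff P i p) + res_diff P i.+1 (k p).
  move=> hE.
  (* The assumption on [h] says exactly that [e] takes its values in the cycles, so [e] lifts
     through the next differential. *)
  pose e : {linear P i.+1 -> P i.+1} := idfun \- f i.+1 \- (h \o res_diff P i).
  have [||k kE] := @lift_to_res_diff P i.+1 _ e.
  - exact: res_proj.
  - by move=> u; rewrite /= !linearB /= hE f_diff subrr.
  by exists k => p; rewrite kE /= [RHS]addrC subrK.
elim=> [|i [h [k hkE]]].
  pose e : {linear P 0%N -> P 0%N} := idfun \- f 0%N.
  have [||h hE] := @lift_to_res_diff P 0 _ e.
  - exact: res_proj.
  - by move=> u; rewrite /= linearB /= f_aug subrr.
  have [|k kE] := next _ h; first by move=> p; rewrite hE.
  by exists h, k.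
have [|l lE] := next _ k; last by exists k, l.
move=> p; have := hkE (res_diff P i.+1 p).
by rewrite res_diffK linear0 add0r => ->.
Qed.

(** Pull [f] back to [P] along [u] and bound it there by [g]; as [u] after [v] is homotopic to the
    identity of [Q], [f] is bounded by [f \o h] plus [g \o v i]. *)
Lemma Ext_eq0_of_resolution P (N : lmodType A) i :
    (forall f : {linear P i.+1 -> N}, cocycle f -> coboundary f) ->
  Ext_eq0 i.+1 M N.
Proof.
move=> PN Q f fd.
have [u [u_aug u_diff]] := comparison_map P Q.
have [v [v_aug v_diff]] := comparison_map Q P.
have [h [k hkE]] : exists (h : {linear Q i -> Q i.+1})
    (k : {linear Q i.+1 -> Q i.+2}), forall q,
    q - u i.+1 (v i.+1 q) = h (res_diff Q i q) + res_diff Q i.+1 (k q).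
  apply: (@comparison_homotopy Q (fun i => u i \o v i)) => [q|j q] /=.
    by rewrite u_aug v_aug.
  by rewrite u_diff v_diff.
have [|g gE] := PN (f \o u i.+1); first by move=> p; rewrite /= -u_diff fd.
exists ((f \o h) \+ (g \o v i)) => q /=; rewrite -v_diff -gE /=.
rewrite -[q in LHS](subrK (u i.+1 (v i.+1 q))) hkE !linearD /=.
by rewrite fd addr0.
Qed.

End Comparison.
(* phi is a parameter only so that it can be recovered from the type when
   looking up the A-module structure. *)
Definition restr (A C : comPzRingType) (phi : {rmorphism A -> C})
  (M : lmodType C) : Type := M.

(** * Restriction of scalars along a ring morphism *)

Section RestrictScalars.
Variables (A C : comPzRingType) (phi : {rmorphism A -> C}) (M : lmodType C).

Local Notation restr := (restr phi M).

HB.instance Definition _ := GRing.Zmodule.on restr.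

Definition restr_scale (a : A) (m : restr) : restr := phi a *: (m : M).

Lemma restr_scaleA a b m :
  restr_scale a (restr_scale b m) = restr_scale (a * b) m.
Proof. by rewrite /restr_scale scalerA rmorphM. Qed.

Lemma restr_scale1 : left_id 1 restr_scale.
Proof. by move=> m; rewrite /restr_scale rmorph1 scale1r. Qed.

Lemma restr_scaleDr : right_distributive restr_scale +%R.
Proof. by move=> a m n; rewrite /restr_scale scalerDr. Qed.

Lemma restr_scaleDl m : {morph restr_scale^~ m : a b / a + b}.
Proof. by move=> a b; rewrite /restr_scale rmorphD scalerDl. Qed.

HB.instance Definition _ := GRing.Zmodule_isLmodule.Build A restr
  restr_scaleA restr_scale1 restr_scaleDr restr_scaleDl.

End RestrictScalars.

(** * Reduction of modules and maps modulo x *)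

Section QuotientMap.
Variables (A : comPzRingType) (x : A).
Implicit Types M N P : lmodType A.

Lemma mod_pi_surj M (u : quot_mod x M) : exists m, mod_pi x m = u.
Proof. by exists (repr u); apply: mod_pi_repr. Qed.

Lemma mod_pi_eq0 M (m : M) : mod_pi x m = 0 <-> exists n, m = x *: n.
Proof.
rewrite -[0](raddf0 (@mod_pi A x M)); split=> [/mod_piP[n]|[n ->]].
  by rewrite subr0; exists n.
by apply/mod_piP; exists n; rewrite subr0.
Qed.

Lemma mod_pi_sub M (m n : M) :
  mod_pi x m = mod_pi x n <-> exists l, m = n + x *: l.
Proof.
split=> [/mod_piP[l mnl]|[l ->]]; last apply/mod_piP; exists l.
  by rewrite -mnl addrC subrK.
by rewrite addrAC subrr add0r.
Qed.

Section Induced.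
Variables (M N : lmodType A) (f : {linear M -> N}).

Definition quot_map (u : quot_mod x M) : quot_mod x N := mod_pi x (f (repr u)).

Lemma quot_mapE m : quot_map (mod_pi x m) = mod_pi x (f m).
Proof.
rewrite /quot_map; apply/mod_pi_sub.
have /mod_pi_sub[l ->] := mod_pi_repr (mod_pi x m).
by exists (f l); rewrite linearD linearZ.
Qed.

Lemma quot_map_linear : linear quot_map.
Proof.
move=> a u v; rewrite -(ring_pi_repr a) -(mod_pi_repr u) -(mod_pi_repr v).
by rewrite -mod_piZ -raddfD !quot_mapE -mod_piZ -raddfD linearP.
Qed.

HB.instance Definition _ := GRing.isLinear.Build (quot_ring x) _ _ *:%R
  quot_map quot_map_linear.

End Induced.

Lemma mod_pi_restr_linear M :
  linear (@mod_pi A x M : M -> restr (@ring_pi A x) (quot_mod x M)).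
Proof.
move=> a m n; rewrite -[LHS]/(mod_pi x (a *: m + n)).
by rewrite raddfD /= mod_piZ.
Qed.

Lemma linear_restr (M N : lmodType (quot_ring x)) (f : {linear M -> N}) :
  linear (f : restr (@ring_pi A x) M -> restr (@ring_pi A x) N).
Proof. by move=> a u v; rewrite linearP. Qed.

(** Restrict scalars to [A] and lift from [P]; x acts as zero on the target, so the lift kills xP
    and descends to P/xP. *)
Lemma quot_mod_projective P : projective P -> projective (quot_mod x P).
Proof.
move=> P_proj M N g f g_surj.
pose M' := restr (@ring_pi A x) M; pose N' := restr (@ring_pi A x) N.
have [g' g'E] := linear_map_exists (linear_restr g).
have [f' f'E] := linear_map_exists (linear_restr f).
have [pi piE] := linear_map_exists (@mod_pi_restr_linear P).
have [|h hE] := P_proj M' N' g' (f' \o pi).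
  by move=> n; have [m <-] := g_surj n; exists m; rewrite g'E.
have hx p : h (x *: p) = 0.
  rewrite linearZ; change (ring_pi x x *: (h p : M) = 0).
  rewrite (_ : ring_pi x x = 0) ?scale0r //.
  rewrite -[0](raddf0 (@ring_pi A x)); apply/ring_piP.
  by exists 1; rewrite subr0 mulr1.
have [|k kE] := @linear_map_exists _ (quot_mod x P) M (fun u => h (repr u)).
  have hpi p : h (repr (mod_pi x p)) = h p.
    have /mod_pi_sub[l ->] := mod_pi_repr (mod_pi x p).
    by rewrite linearD hx addr0.
  move=> a u v; rewrite -(ring_pi_repr a) -(mod_pi_repr u) -(mod_pi_repr v).
  by rewrite -mod_piZ -raddfD !hpi linearP.
exists k => u; rewrite kE; have := hE (repr u); rewrite g'E /= f'E piE => ->.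
by rewrite mod_pi_repr.
Qed.

Lemma quot_mod_lift P N (f : {linear quot_mod x P -> quot_mod x N}) :
    projective P ->
  exists g : {linear P -> N}, forall p, mod_pi x (g p) = f (mod_pi x p).
Proof.
move=> P_proj.
have [f' f'E] := linear_map_exists (linear_restr f).
have [pi piE] := linear_map_exists (@mod_pi_restr_linear P).
have [pi' pi'E] := linear_map_exists (@mod_pi_restr_linear N).
have [|g gE] := P_proj _ _ pi' (f' \o pi).
  by move=> u; have [n <-] := mod_pi_surj u; exists n; rewrite pi'E.
by exists g => p; have := gE p; rewrite pi'E /= f'E piE.
Qed.

Lemma quot_mod_finite M : finite_module M -> finite_module (quot_mod x M).
Proof.
case=> n [g gE]; exists n, (fun i => mod_pi x (g i)) => u.
have [m <-] := mod_pi_surj u; have [c ->] := gE m.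
exists (fun i => ring_pi x (c i)); rewrite raddf_sum /=.
by apply: eq_bigr => i _; rewrite mod_piZ.
Qed.

End QuotientMap.

Arguments quot_map {A} x {M N} f u.

(** * Exact pairs on projective modules, and homotheties elementwise *)

Section ExactPair.
Variable A : comPzRingType.
Implicit Types (x y : A) (M P : lmodType A).

Definition exact_pair M x y : Prop :=
  (forall m : M, y *: m = 0 <-> exists n, m = x *: n) /\
  (forall m : M, x *: m = 0 <-> exists n, m = y *: n).

Lemma exact_pairC M x y : exact_pair M x y -> exact_pair M y x.
Proof. by case. Qed.

Lemma exact_zero_divisors_pair M x y :
  exact_zero_divisors M x y -> exact_pair M x y.
Proof. by case. Qed.

Lemma exact_pair_ring_mul x y : exact_pair A^o x y -> y * x = 0.
Proof.
by case=> yx _; apply/(yx x); exists 1; rewrite -[RHS]/(x * 1) mulr1.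
Qed.

Lemma exact_pair_mul M x y m : exact_pair A^o x y -> y *: (x *: m) = 0 :> M.
Proof. by move=> /exact_pair_ring_mul yx0; rewrite scalerA yx0 scale0r. Qed.

(** A section [s] of the free cover embeds P in a free module, where exactness can be checked on
    each coordinate in [A]. *)
Lemma projective_exact P x y :
  projective P -> exact_pair A^o x y -> exact_pair P x y.
Proof.
move=> P_proj.
suff half u v : exact_pair A^o u v ->
    forall m : P, v *: m = 0 <-> exists n, m = u *: n.
  by move=> xy; split; apply: half => //; apply: exact_pairC.
move=> uv m; split=> [vm0|[n ->]]; last exact: exact_pair_mul.
have [s sE] := P_proj _ _ (Defs.cover P) idfun (@cover_surj _ P).
have /choice[c cE] t : exists a : A, s m t = u * a.
  apply/(uv.1 (s m t)); rewrite -[LHS]/(v * s m t) -freeZ -linearZ vm0.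
  by rewrite linear0.
(* The sum is cut off at the support of [s m] because the chosen [c] may be nonzero outside it. *)
exists (Defs.cover P (\sum_(t <- supp (s m)) c t *: single A t)).
rewrite -linearZ -[LHS]sE; congr (Defs.cover P _).
rewrite [LHS]free_expand scaler_sumr; apply: eq_bigr => t _.
by rewrite scalerA -cE.
Qed.

End ExactPair.

Lemma homothety_bijectiveP (A : comPzRingType) (B : lmodType A) :
  bijective (@homothety A B) <->
  (forall a, (forall b : B, a *: b = 0) -> a = 0) /\
  (forall h : {linear B -> B}, exists a, forall b, h b = a *: b).
Proof.
split=> [bij|[faithful surj]].
  split=> [a aB|h]; last by have [a <-] := surj_of_bijective bij h; exists a.
  apply: (bij_inj bij); apply: linear_ext => b.
  by rewrite [LHS]aB [RHS]scale0r.
apply: bijective_of_inj_surj => [a a' aa'|h].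
  apply/eqP; rewrite -subr_eq0; apply/eqP/faithful => b.
  rewrite scalerBl; apply/eqP; rewrite subr_eq0; apply/eqP.
  exact: (congr1 (fun h : {linear B -> B} => h b) aa').
by have [a hE] := surj h; exists a; apply: linear_ext => b; rewrite hE.
Qed.

(** * The resolution modulo x, and semidualizing quotients in terms of lifts *)

Section Reduction.
Variables (R : comPzRingType) (B : lmodType R) (P : projective_resolution B).
Implicit Types x y : R.

Lemma res_mod_exact0 x p b : res_aug P p = x *: b ->
  exists q p', p = res_diff P 0 q + x *: p'.
Proof.
have [p2 <-] := res_aug_surj P b => px.
have /res_exact0[q qE] : res_aug P (p - x *: p2) = 0.
  by rewrite linearB linearZ px subrr.
by exists q, p2; rewrite qE subrK.
Qed.

(* H_i(P/xP) = 0 by induction on i: d p = x q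
   forces x (d q) = 0, hence d q = y q', which is the same situation one degree
   lower with x and y exchanged. *)
Lemma res_mod_exact i : forall x y, exact_pair R^o x y -> exact_pair B x y ->
  forall (p : P i.+1) (q : P i), res_diff P i p = x *: q ->
  exists p1 p2, p = res_diff P i.+1 p1 + x *: p2.
Proof.
(* With [q] equal to a boundary modulo v and u v = 0, the element [p - u *: q1] is a cycle, hence a
   boundary. *)
have step j u v (p : P j.+1) (q : P j) q1 q2 : exact_pair R^o u v ->
    res_diff P j p = u *: q -> q = res_diff P j q1 + v *: q2 ->
    exists p1 p2, p = res_diff P j.+1 p1 + u *: p2.
  move=> uvR pE qE; have /res_exact[p1 p1E] : res_diff P j (p - u *: q1) = 0.
    rewrite linearB linearZ /= pE qE scalerDr addrAC subrr add0r.
    exact/exact_pair_mul/exact_pairC.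
  by exists p1, q1; rewrite p1E subrK.
elim: i => [|i IH] x y xyR xyB p q px.
  have [b /res_mod_exact0[q1 [q2]]] : exists b, res_aug P q = y *: b.
    by apply/xyB.2; rewrite -linearZ /= -px res_augK.
  exact: step px.
have [q' dq] : exists q', res_diff P i q = y *: q'.
  apply/(projective_exact (@res_proj _ _ P i) xyR).2.
  by rewrite -linearZ /= -px res_diffK.
have [q1 [q2]] := IH y x (exact_pairC xyR) (exact_pairC xyB) _ _ dq.
exact: step px.
Qed.

(* Since each P_i is projective, R-linear maps P_i -> B/xB lift to P_i -> B. The
   next three predicates thus say, in terms of lifts, that R/xR -> Hom_R(B, B/xB)
   is injective, that it is surjective, and that Ext^(i+1)_R(B, B/xB) = 0. *)
Definition faithful_mod x : Prop := forall s : R,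
  (forall b : B, exists b', s *: b = x *: b') -> exists t, s = x * t.

Definition hom_mod_homothety x : Prop := forall g : {linear P 0%N -> B},
  (forall p, exists b, g (res_diff P 0 p) = x *: b) ->
  exists s, forall p, exists b, g p = s *: res_aug P p + x *: b.

Definition ext_mod_eq0 x i : Prop := forall f : {linear P i.+1 -> B},
  (forall p, exists b, f (res_diff P i.+1 p) = x *: b) ->
  exists g : {linear P i -> B}, forall p, exists b,
    f p = g (res_diff P i p) + x *: b.

Section Quotient.
Variables x y : R.
Hypotheses (xyR : exact_pair R^o x y) (xyB : exact_pair B x y).

Lemma quot_res_aug_surj (u : quot_mod x B) :
  exists v, quot_map x (res_aug P) v = u.
Proof.
have [b <-] := mod_pi_surj u; have [p <-] := res_aug_surj P b.
by exists (mod_pi x p); rewrite quot_mapE.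
Qed.

Lemma quot_res_exact0 (u : quot_mod x (P 0%N)) :
  quot_map x (res_aug P) u = 0 <->
  exists v, quot_map x (res_diff P 0) v = u.
Proof.
split=> [|[v <-]].
  have [p <-] := mod_pi_surj u; rewrite quot_mapE => /mod_pi_eq0[b].
  move=> /res_mod_exact0[q [p' ->]]; exists (mod_pi x q).
  by rewrite quot_mapE; apply/esym/mod_pi_sub; exists p'.
have [p <-] := mod_pi_surj v.
by rewrite !quot_mapE res_augK raddf0.
Qed.

Lemma quot_res_exact i (u : quot_mod x (P i.+1)) :
  quot_map x (res_diff P i) u = 0 <->
  exists v, quot_map x (res_diff P i.+1) v = u.
Proof.
split=> [|[v <-]].
  have [p <-] := mod_pi_surj u; rewrite quot_mapE => /mod_pi_eq0[b].
  move=> /(res_mod_exact xyR xyB)[q [p' ->]]; exists (mod_pi x q).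
  by rewrite quot_mapE; apply/esym/mod_pi_sub; exists p'.
have [p <-] := mod_pi_surj v.
by rewrite !quot_mapE res_diffK raddf0.
Qed.

Definition quot_resolution : projective_resolution (quot_mod x B) :=
  Build_projective_resolution
    (fun i => quot_mod_projective (@res_proj _ _ P i))
    quot_res_aug_surj quot_res_exact0 quot_res_exact.

(** Endomorphisms of B/xB correspond to maps from P_0 to B that send boundaries into xB, taken
    modulo x: projectivity gives the lift, and [linear_factor] the descent. *)
Lemma quot_homothety_bijectiveP :
  bijective (@homothety (quot_ring x) (quot_mod x B)) <->
  faithful_mod x /\ hom_mod_homothety x.
Proof.
rewrite homothety_bijectiveP; split=> -[faithful surj]; split.
- move=> s sB; have : ring_pi x s = 0.
    apply: faithful => u; have [b <-] := mod_pi_surj u.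
    by rewrite -mod_piZ; apply/mod_pi_eq0.
  rewrite -[0](raddf0 (@ring_pi R x)) => /ring_piP[t].
  by rewrite subr0; exists t.
- move=> g gx.
  have [|h hE] := @linear_factor _ _ _ _ (res_aug quot_resolution)
      (quot_map x g) quot_res_aug_surj.
    move=> u /quot_res_exact0[v <-]; have [p <-] := mod_pi_surj v.
    by rewrite quot_mapE [LHS]quot_mapE; apply/mod_pi_eq0; apply: gx.
  have [a aE] := surj h; exists (repr a) => p; apply/mod_pi_sub.
  rewrite mod_piZ ring_pi_repr -aE -quot_mapE -(hE (mod_pi x p)) /=.
  by rewrite quot_mapE.
- move=> a; rewrite -(ring_pi_repr a) => aB.
  rewrite -[RHS](raddf0 (@ring_pi R x)); apply/ring_piP.
  have [b|t tE] := faithful (repr a); last by exists t; rewrite subr0.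
  by apply/mod_pi_eq0; rewrite mod_piZ.
move=> h.
have [|g gE] := @quot_mod_lift _ x _ _ (h \o quot_map x (res_aug P)).
  exact: res_proj.
have [|s sE] := surj g.
  move=> p; apply/mod_pi_eq0; rewrite gE /= quot_mapE res_augK.
  by rewrite raddf0 linear0.
exists (ring_pi x s) => u; have [v <-] := quot_res_aug_surj u.
have [p <-] := mod_pi_surj v; have /mod_pi_sub := sE p.
by rewrite gE /= quot_mapE mod_piZ.
Qed.

(** Lifting cochains on P/xP to maps into B turns the cocycle and coboundary equations into
    congruences modulo x; one resolution suffices by [Ext_eq0_of_resolution]. *)
Lemma quot_Ext_eq0P i :
  Ext_eq0 i.+1 (quot_mod x B) (quot_mod x B) <-> ext_mod_eq0 x i.
Proof.
split=> [ext0 f fx|ext0].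
  have [|g gE] := ext0 quot_resolution (quot_map x f).
    move=> u; have [p <-] := mod_pi_surj u.
    by rewrite /= !quot_mapE; apply/mod_pi_eq0.
  have [|g' g'E] := quot_mod_lift g; first exact: res_proj.
  exists g' => p; apply/mod_pi_sub.
  by rewrite g'E -quot_mapE gE /= quot_mapE.
apply: (@Ext_eq0_of_resolution _ _ quot_resolution) => f fx.
have [|f' f'E] := quot_mod_lift f; first exact: res_proj.
have [p|g gE] := ext0 f'.
  by apply/mod_pi_eq0; rewrite f'E -quot_mapE; apply: fx.
exists (quot_map x g) => u; have [p <-] := mod_pi_surj u.
by rewrite -f'E /= !quot_mapE; apply/mod_pi_sub.
Qed.

Lemma quot_semidualizingP : finite_module B ->
  semidualizing (quot_mod x B) <->
  [/\ faithful_mod x, hom_mod_homothety x & forall i, ext_mod_eq0 x i].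
Proof.
move=> finB; split=> [[_ homothety_bij ext0]|[faithful hom ext0]].
  have [faithful hom] := quot_homothety_bijectiveP.1 homothety_bij.
  by split=> // i; apply/quot_Ext_eq0P/ext0.
split; first exact: quot_mod_finite.
  exact/quot_homothety_bijectiveP.
by case=> // i _; apply/quot_Ext_eq0P.
Qed.

End Quotient.
End Reduction.

(** * Passage between B and its quotients B/xB and B/yB *)

Section ChangeOfModule.
Variables (R : comPzRingType) (B : lmodType R).
Implicit Types x y : R.

(** If sB lies in xB, then y s kills B, so y s = 0 and exactness on the ring puts s in xR. *)
Lemma semidualizing_faithful_mod x y :
  exact_pair R^o x y -> exact_pair B x y -> semidualizing B -> faithful_mod B x.
Proof.
move=> xyR xyB [_ /homothety_bijectiveP[faithful _] _] s sB.
apply/(xyR.1 s); rewrite -[LHS]/(y * s); apply: faithful => b.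
by have [b' b'E] := sB b; rewrite -scalerA b'E; apply: exact_pair_mul.
Qed.

Lemma projective_divide x y (P : lmodType R) (f : {linear P -> B}) :
    projective P -> exact_pair B x y -> (forall p, y *: f p = 0) ->
  exists g : {linear P -> B}, forall p, f p = x *: g p.
Proof.
move=> P_proj [yB _] yf.
exact: (projective_lift_ker (u := x \*: idfun) (v := y \*: idfun)).
Qed.

Lemma semidualizing_hom_mod (P : projective_resolution B) x y :
  exact_pair R^o x y -> exact_pair B x y -> semidualizing B ->
  hom_mod_homothety P x.
Proof.
move=> xyR xyB [_ /homothety_bijectiveP[faithful surj] _] g gx.
have [|h hE] := linear_factor (g := y \*: g) (@res_aug_surj _ _ P).
  move=> p /res_exact0[q <-] /=; have [b ->] := gx q.
  exact: exact_pair_mul.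
have [r rE] := surj h.
have [s sE] : exists s, r = y * s.
  apply/(xyR.2 r); rewrite -[LHS]/(x * r); apply: faithful => b.
  have [p <-] := res_aug_surj P b; rewrite -scalerA -rE hE /=.
  exact/exact_pair_mul/exact_pairC.
exists s => p; have [b bE] : exists b, g p - s *: res_aug P p = x *: b.
  by apply/xyB.1; rewrite scalerBr scalerA -sE -rE hE subrr.
by exists b; rewrite -bE addrC subrK.
Qed.

Lemma semidualizing_ext_mod (P : projective_resolution B) :
  semidualizing B -> forall i x y,
  exact_pair R^o x y -> exact_pair B x y -> ext_mod_eq0 P x i.
Proof.
move=> sdB; have [_ _ ext0] := sdB.
(* Dimension shift: [y \*: f] is a cocycle, so it is [g] after the differential, and [g] is a
   cocycle modulo y. Once [g] is a true cocycle [h] plus y times some [l], the map [f] minus [l]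
   after the differential is killed by y, hence lies in xB. *)
have step i x y (f : {linear P i.+1 -> B}) :
    exact_pair R^o x y -> exact_pair B x y ->
    (forall p, exists b, f (res_diff P i.+1 p) = x *: b) ->
    (forall g : {linear P i -> B},
      (forall p, exists b, g (res_diff P i p) = y *: b) ->
      exists2 h : {linear P i -> B}, forall p, h (res_diff P i p) = 0 &
        forall p, exists b, g p = h p + y *: b) ->
    exists l : {linear P i -> B}, forall p, exists b,
      f p = l (res_diff P i p) + x *: b.
  move=> xyR xyB fx split_cocycle.
  have [|g /= gE] := ext0 i.+1 isT P (y \*: f).
    by move=> p /=; have [b ->] := fx p; apply: exact_pair_mul.
  have [|h hd hE] := split_cocycle g.
    by move=> p; exists (f p); rewrite gE.
  have [||p|l lE] := @projective_divide y x _ (g \- h).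
  - exact: res_proj.
  - exact: exact_pairC.
  - rewrite /=; have [b ->] := hE p; rewrite addrAC subrr add0r.
    exact/exact_pair_mul/exact_pairC.
  exists l => p; have [b bE] : exists b, f p - l (res_diff P i p) = x *: b.
    by apply/xyB.1; rewrite scalerBr -lE /= hd subr0 -gE subrr.
  by exists b; rewrite -bE addrC subrK.
elim=> [|i IH] x y xyR xyB f fx; apply: (step _ x y) => // g gy.
  (* In degree 0, [g] is a homothety of the augmentation modulo y, which is a true cocycle. *)
  have [s sE] :=
    semidualizing_hom_mod (exact_pairC xyR) (exact_pairC xyB) sdB gy.
  by exists (s \*: res_aug P) => p //=; rewrite res_augK scaler0.
have [k kE] := IH y x (exact_pairC xyR) (exact_pairC xyB) g gy.
by exists (k \o res_diff P i) => p //=; rewrite res_diffK linear0.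
Qed.

(** Solve modulo x; the error is x times a cofactor, which is then solved modulo y. The remaining
    error vanishes since x y = 0. *)
Lemma semidualizing_of_quot x y :
    finite_module B -> exact_pair R^o x y -> exact_pair B x y ->
    semidualizing (quot_mod x B) -> semidualizing (quot_mod y B) ->
  semidualizing B.
Proof.
move=> finB xyR xyB sdx sdy.
have yxR := exact_pairC xyR; have yxB := exact_pairC xyB.
have quot (P : projective_resolution B) :
    [/\ faithful_mod B x, hom_mod_homothety P x &
      forall i, ext_mod_eq0 P x i] /\
    [/\ faithful_mod B y, hom_mod_homothety P y &
      forall i, ext_mod_eq0 P y i].
  by split; [apply/(quot_semidualizingP P xyR xyB) |
             apply/(quot_semidualizingP P yxR yxB)].
(* The cofactor [l] is a cocycle modulo y: x kills its values on boundaries, and the kernel of x on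
   B is yB. *)
have divide (P : projective_resolution B) i (f g : {linear P i -> B}) :
    (forall p, f (res_diff P i p) = g (res_diff P i p)) ->
    (forall p, exists b, f p = g p + x *: b) ->
    exists l : {linear P i -> B}, (forall p, f p = g p + x *: l p) /\
      forall p, exists b, l (res_diff P i p) = y *: b.
  move=> fgd fg; have [||p|l lE] := @projective_divide x y _ (f \- g).
  - exact: res_proj.
  - exact: xyB.
  - have [b /= ->] := fg p; rewrite addrAC subrr add0r.
    exact: exact_pair_mul.
  exists l; split=> p; first by rewrite -lE /= addrC subrK.
  by apply/xyB.2; rewrite -lE /= fgd subrr.
split=> //.
  have [P] := projective_resolution_exists B.
  have [[faithx homx _] [faithy homy _]] := quot P.
  apply/homothety_bijectiveP; split=> [r rB|h].
    have [b|s rE] := faithx r; first by exists 0; rewrite rB scaler0.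
    have [b|t sE] := faithy s.
      by apply/xyB.2; rewrite scalerA -rE rB.
    rewrite rE sE; apply: (exact_pair_mul (M := R^o)).
    exact: yxR.
  have [|s sE] := homx (h \o res_aug P).
    by move=> p; exists 0; rewrite /= res_augK linear0 scaler0.
  have [|l [lE /homy[t tE]]] :=
      divide _ _ (h \o res_aug _) (s \*: res_aug _) _ sE.
    by move=> p /=; rewrite res_augK linear0 scaler0.
  (* Here [s] represents [h] modulo x, and [t] represents the cofactor [l] modulo y. *)
  exists (s + x * t) => b; have [p <-] := res_aug_surj P b.
  rewrite [LHS]lE /=; have [b' ->] := tE p.
  by rewrite scalerDr [x *: (y *: _)]exact_pair_mul // addr0 scalerDl scalerA.
case=> // i _ P f fd; have [[_ _ extx] [_ _ exty]] := quot P.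
have [|k kE] := extx i f; first by move=> p; exists 0; rewrite fd scaler0.
have [|l [lE /exty[m mE]]] := divide _ _ f (k \o res_diff P i) _ kE.
  by move=> p /=; rewrite fd res_diffK linear0.
(* The cochain [k] bounds [f] modulo x, and [m] bounds the cofactor [l] modulo y. *)
exists (k \+ x \*: m) => p; rewrite lE /=; have [b ->] := mE p.
by rewrite scalerDr [x *: (y *: _)]exact_pair_mul ?addr0.
Qed.

Lemma quot_semidualizing x y :
    exact_pair R^o x y -> exact_pair B x y -> semidualizing B ->
  semidualizing (quot_mod x B).
Proof.
move=> xyR xyB sdB; have [finB _ _] := sdB.
apply/(quot_semidualizingP (free_resolution B) xyR xyB finB); split.
- exact: semidualizing_faithful_mod xyR xyB sdB.
- exact: semidualizing_hom_mod xyR xyB sdB.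
by move=> i; apply: semidualizing_ext_mod xyR xyB.
Qed.

End ChangeOfModule.

Theorem proposition3p4 (R : comPzRingType) (B : lmodType R) (x y : R) :
  noetherian R -> finite_module B ->
  exact_zero_divisors R^o x y -> exact_zero_divisors B x y ->
  (semidualizing B <->
   @semidualizing (quot_ring x) (quot_mod x B) /\
   @semidualizing (quot_ring y) (quot_mod y B)).
Proof.
move=> _ finB /exact_zero_divisors_pair xyR /exact_zero_divisors_pair xyB.
split=> [sdB|[sdx sdy]]; last exact: semidualizing_of_quot sdx sdy.
split; first exact: quot_semidualizing xyR xyB sdB.
exact: quot_semidualizing (exact_pairC xyR) (exact_pairC xyB) sdB.
Qed.
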